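(* Let $d_n$ be a sequence of directed metrics of negative sign on $\mathbb{R}^2$ with $d_n(x,s;y,t)=-\infty$ for $s>t$, and let $d$ be a directed metric of negative sign on $\mathbb{R}^2$, continuous on $\mathbb{R}^4_\circ$ and finite on $\mathbb{R}^4_\uparrow$, such that $\mathfrak{g}d_n\to\mathfrak{g}d$ in $\mathcal{E}_*$. Let $b_n>0$, $a_n\in\mathbb{R}$ with $b_n\to\infty$ and $a_n/b_n\to0$, and let $\ell_n$ be the additive metric $\ell_n(p,q)=\ell_n(q)-\ell_n(p)$ with $\ell_n(x,t)=a_nx+b_nt$. Assume that $(d_n+\ell_n)(x,s;x,t)\ge0$ for all $x\in\mathbb{R}$, $s\le t$. Define $$i_n(y,t;x,s)=b_nI_{d_n+\ell_n}\big((x,s);b_n(s-t)\big)(y)-b_nt-a_n(x-y),\qquad(y,t;x,s)\in\mathbb{R}^4_\uparrow.$$ Then $i_n\to d$ uniformly on compact subsets of $\mathbb{R}^4_\uparrow$. Moreover, letting $$\tilde h_n(y,t;x,g)=b_nI_{d_n+\ell_n}\big((x,(g-a_nx)/b_n);b_nt\big)(y)+b_nt+a_ny,$$ we have $\tilde h_n(y,t;x,g)\to d(y,-t;x,0)+g$ uniformly on compact subsets of $(y,t;x,g)\in\mathbb{R}\times(0,\infty)\times\mathbb{R}^2$.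
   Context: A directed metric of negative sign on $\mathbb{R}^2$ is $d:\mathbb{R}^2\times\mathbb{R}^2\to\mathbb{R}\cup\{-\infty\}$ with $d(p,p)=0$ and $d(p,r)\ge d(p,q)+d(q,r)$. $\mathbb{R}^4_\uparrow=\{(x,s;y,t)\in\mathbb{R}^4:s<t\}$, $\mathbb{R}^4_\circ=\{(p,q)\in\mathbb{R}^2\times\mathbb{R}^2:p\ne q\}$, $\bar{\mathbb{R}}=[-\infty,\infty]$. Interfaces. For a directed metric $d$ of negative sign, $p\in\mathbb{R}^2$ and $r\in\mathbb{R}$, the backwards ball is $B_d(p,r)=\{q\in\mathbb{R}^2:d(q,p)>r\}$, with Euclidean closure $\bar B_d(p,r)$, and the interface of radius $r$ centered at $p$ is the function $I_d(p;r)(y)=\sup\{w\in\mathbb{R}:(y,w)\in\bar B_d(p,r)\}$, $y\in\mathbb{R}$. Graph convergence in $\mathcal{E}_*$. For $f:\mathbb{R}^4_\circ\to\bar{\mathbb{R}}$, $\mathfrak{g}f$ is the closure of $\{(r,f(r))\}$ in $\mathbb{R}^4_\circ\times\bar{\mathbb{R}}$. For $r=(p,q)\in\mathbb{R}^4_\circ$ let $E(r,a)=(r,|p-q|e^{-|r|}a/(1+|a|))$ ($a/(1+|a|)=\pm1$ at $a=\pm\infty$). $\mathfrak{g}f_n\to\mathfrak{g}f$ in $\mathcal{E}_*$ if the Hausdorff distance between $E(\mathfrak{g}f_n)$ and $E(\mathfrak{g}f)$ tends to $0$. *)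

(* Defs.v *)
From HB Require Import structures.
From mathcomp Require Import all_boot all_order all_algebra.
From mathcomp Require Import all_classical all_reals all_analysis.

Set Implicit Arguments.
Unset Strict Implicit.
Unset Printing Implicit Defensive.

Import Order.TTheory GRing.Theory Num.Theory.
Import numFieldNormedType.Exports.

Local Open Scope classical_set_scope.
Local Open Scope ring_scope.

(* A point (x, s; y, t) of R^4 is the pair ((x, s), (y, t)) of planar points. *)
Notation plane R := (R * R)%type.
Notation plane2 R := (plane R * plane R)%type.

Definition R4up (R : realType) : set (plane2 R) := [set r | r.1.2 < r.2.2].

Definition R4circ (R : realType) : set (plane2 R) := [set r | r.1 <> r.2].

(* The value +oo is excluded, so d (p, q) + d (q, r) is never of the form
   oo - oo. *)
Definition directed_metric (R : realType) (d : plane2 R -> \bar R) : Prop :=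
  [/\ forall u, d u != +oo%E,
      forall p, d (p, p) = 0%E
    & forall p q r, (d (p, q) + d (q, r) <= d (p, r))%E].

Definition additive_metric (R : realType) (l : plane R -> R)
  (u : plane2 R) : R := l u.2 - l u.1.

Definition linear_form (R : realType) (a b : R) (p : plane R) : R :=
  a * p.1 + b * p.2.

Definition add_metric (R : realType) (d : plane2 R -> \bar R)
  (l : plane2 R -> R) (u : plane2 R) : \bar R := (d u + (l u)%:E)%E.

Definition add_linear (R : realType) (d : plane2 R -> \bar R) (a b : R) :
  plane2 R -> \bar R := add_metric d (additive_metric (linear_form a b)).

Definition backward_ball (R : realType) (d : plane2 R -> \bar R)
  (p : plane R) (r : R) : set (plane R) := [set q | (r%:E < d (q, p))%E].

(* The supremum is taken in the extended reals: it is -oo when no such w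
   exists and +oo when they are unbounded. *)
Definition interface (R : realType) (d : plane2 R -> \bar R)
  (p : plane R) (r : R) (y : R) : \bar R :=
  ereal_sup [set w%:E | w in [set w | closure (backward_ball d p r) (y, w)]].

(* The library's norm on a product is the sup norm, hence the explicit
   Euclidean norms. *)
Definition sqnorm2 (R : realType) (p : plane R) : R := p.1 ^+ 2 + p.2 ^+ 2.

Definition norm2 (R : realType) (p : plane R) : R := Num.sqrt (sqnorm2 p).

Definition sqnorm4 (R : realType) (r : plane2 R) : R :=
  sqnorm2 r.1 + sqnorm2 r.2.

Definition norm4 (R : realType) (r : plane2 R) : R := Num.sqrt (sqnorm4 r).

Definition dist5 (R : realType) (u v : plane2 R * R) : R :=
  Num.sqrt (sqnorm4 (u.1 - v.1) + (u.2 - v.2) ^+ 2).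

(* Closure relative to R4circ x \bar R, i.e. the trace on that subspace of the
   closure in R^4 x \bar R. *)
Definition closed_graph (R : realType) (f : plane2 R -> \bar R) :
  set (plane2 R * \bar R) :=
  closure [set z | R4circ z.1 /\ z.2 = f z.1] `&` [set z | R4circ z.1].

(* contract a = a / (1 + |a|), with contract (+oo) = 1, contract (-oo) = -1. *)
Definition graph_embedding (R : realType) (z : plane2 R * \bar R) :
  plane2 R * R :=
  (z.1, norm2 (z.1.1 - z.1.2) * expR (- norm4 z.1) * contract z.2).

Definition hausdorff_dist (R : realType) (T : Type) (dist : T -> T -> R)
  (A B : set T) : \bar R :=
  maxe (ereal_sup [set ereal_inf [set (dist a b)%:E | b in B] | a in A])
       (ereal_sup [set ereal_inf [set (dist a b)%:E | a in A] | b in B]).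

Definition graph_cvg (R : realType) (f_ : nat -> plane2 R -> \bar R)
  (f : plane2 R -> \bar R) : Prop :=
  hausdorff_dist (@dist5 R) (@graph_embedding R @` closed_graph (f_ n))
    (@graph_embedding R @` closed_graph f) @[n --> \oo] --> 0%E.

(* Uniform convergence on the compact subsets of D towards a limit g which is
   finite on D; the f_ n may take infinite values, and the estimate then forces
   f_ n to be finite on K for n large. The distance is that of the reals, not
   the bounded one of the library's uniform structure on \bar R. *)
Definition cvg_unif_on_compacts (R : realType) (T : topologicalType)
  (D : set T) (f_ : nat -> T -> \bar R) (g : T -> \bar R) : Prop :=
  forall K : set T, compact K -> K `<=` D ->
  forall e : R, 0 < e ->
  \forall n \near \oo, forall u, K u -> (`|f_ n u - g u| < e%:E)%E.

(* In the next two definitions m stands for the metric d_n + l_n, a for a_n and b for b_n. *)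
Definition rescaled_interface (R : realType) (a b : R) (m : plane2 R -> \bar R)
  (u : plane2 R) : \bar R :=
  let: ((y, t), (x, s)) := u in
  (b%:E * interface m (x, s) (b * (s - t))%R y
   - (b * t)%R%:E - (a * (x - y))%R%:E)%E.

Definition rescaled_height (R : realType) (a b : R) (m : plane2 R -> \bar R)
  (u : plane2 R) : \bar R :=
  let: ((y, t), (x, g)) := u in
  (b%:E * interface m (x, ((g - a * x) / b)%R) (b * t)%R y
   + (b * t)%R%:E + (a * y)%R%:E)%E.

Definition height_limit (R : realType) (d : plane2 R -> \bar R)
  (u : plane2 R) : \bar R :=
  let: ((y, t), (x, g)) := u in (d ((y, (- t)%R), (x, 0%R)) + g%:E)%E.

(* Main.v *)
Require Import Defs.
From HB Require Import structures.
From mathcomp Require Import all_boot all_order all_algebra.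
From mathcomp Require Import all_classical all_reals all_analysis.
From mathcomp Require Import ring lra.

Import Order.TTheory GRing.Theory Num.Theory.
Import numFieldNormedType.Exports.

Set Implicit Arguments.
Unset Strict Implicit.
Unset Printing Implicit Defensive.

Local Open Scope classical_set_scope.
Local Open Scope ring_scope.

(* For v in R put w_n = t + (v + a_n (x - y)) / b_n. Then (y, w_n) lies in the
   backward ball defining i_n (y, t; x, s) iff d_n (y, w_n; x, s) > v, and
   w_n -> t. As graph convergence to a continuous limit gives
   d_n (u_n) -> d (u) whenever u_n -> u, this yields i_n >= v for v < d (u).
   Conversely, dl_ge0 makes the ball closed under going down in time, so a point
   of its closure above w_n forces d_n (y', w_n; x, s) > v - o(1) for some y'
   arbitrarily close to y, which is excluded when v > d (u). The second claim is
   the first one at s = (g - a_n x) / b_n and time s - t, since s -> 0. *)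

(** * Extended-real limits, and graph convergence to a continuous limit *)

(** Bounds at [l - e] and [l + e] also force eventual finiteness. They are taken non-strict because
    this is the form in which a supremum is bounded. *)
Lemma cvg_EFin_between (R : realType) (I : Type) (F : set_system I)
    (FF : Filter F) (f : I -> \bar R) (l : R) :
  (forall c, c < l -> \forall i \near F, (c%:E <= f i)%E) ->
  (forall c, l < c -> \forall i \near F, (f i <= c%:E)%E) ->
  f x @[x --> F] --> l%:E.
Proof.
move=> lo up.
have fin c c' x : (c%:E <= x)%E -> (x <= c'%:E)%E -> x \is a @fin_num R.
  by case: x.
have bnd e : 0 < e -> \forall i \near F, ((l - e)%:E <= f i <= (l + e)%:E)%E.
  move=> e0; have := up (l + e); have := lo (l - e).
  rewrite ltrBlDr ltrDl => /(_ e0) lo' /(_ e0) up'.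
  by near=> i; apply/andP; split; near: i.
apply/fine_cvgP; split.
  have := bnd 1 ltr01; apply: filterS => i /andP[]; exact: fin.
apply/cvgrPdist_le => e /bnd; apply: filterS => i /=.
move: (f i) => [x||] //=; last by rewrite leye_eq andbF.
by rewrite !lee_fin => /andP[? ?]; rewrite ler_norml; apply/andP; split; lra.
Unshelve. all: by end_near. Qed.

(** Each squared coordinate difference is at most the sum of all five. This passes from the
    Euclidean distance of the statement to sup-norm balls. *)
Lemma dist5_ball (R : realType) (z z' : plane2 R * R) (e : R) :
  dist5 z z' < e -> ball z.1 e z'.1 /\ `|z.2 - z'.2| < e.
Proof.
case: z z' => [[[x s] [y t]] a] [[[x' s'] [y' t']] a'].
rewrite /dist5 /sqnorm4 /sqnorm2 /= => ze.
have le_sqrt (p q : R) : 0 <= q - p ^+ 2 -> `|p| <= Num.sqrt q.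
  by move=> pq; rewrite -sqrtr_sqr ler_wsqrtr // -subr_ge0.
have := sqr_ge0 (x - x'); have := sqr_ge0 (s - s'); have := sqr_ge0 (y - y').
have := sqr_ge0 (t - t'); have := sqr_ge0 (a - a') => ? ? ? ? ?.
do !split; apply: le_lt_trans ze; apply: le_sqrt => /=; lra.
Qed.

(** Every neighbourhood of the value in the closure meets every neighbourhood of [d z.1], and the
    extended reals are Hausdorff. *)
Lemma closed_graph_continuous (R : realType) (d : plane2 R -> \bar R) z :
  closed_graph d z -> {for z.1, continuous d} -> z.2 = d z.1.
Proof.
case: z => u a [clz _] dz; apply: ereal_hausdorff => A B zA dB.
have [|[v c] [[/= _ ->] [Bv Ac]]] := clz ((d @^-1` B) `*` A).
  by exists (d @^-1` B, A) => //; split=> //; exact: dz.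
by exists (d v).
Qed.

Lemma graph_weight_continuous (R : realType) :
  continuous (fun u : plane2 R => norm2 (u.1 - u.2) * expR (- norm4 u)).
Proof.
move=> u.
have sqn2 : continuous (@sqnorm2 R).
  by move=> v; apply: cvgD; apply: cvgM; (exact: cvg_fst || exact: cvg_snd).
have n2 : continuous (@norm2 R).
  by move=> v; apply: continuous_comp; [exact: sqn2|exact: sqrt_continuous].
apply: cvgM.
  apply: (@continuous_comp _ _ _ (fun u : plane2 R => u.1 - u.2)); last exact: n2.
  by apply: cvgB; [exact: cvg_fst|exact: cvg_snd].
apply: (@continuous_comp _ _ _ (fun u : plane2 R => - norm4 u)).
  2: exact: continuous_expR.
apply: cvgN; apply: (@continuous_comp _ _ _ (@sqnorm4 R)).
  2: exact: sqrt_continuous.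
apply: cvgD.
  by apply: (@continuous_comp _ _ _ fst); [exact: cvg_fst|exact: sqn2].
by apply: (@continuous_comp _ _ _ snd); [exact: cvg_snd|exact: sqn2].
Qed.

Lemma open_R4circ (R : realType) : open (@R4circ R).
Proof.
have -> : R4circ (R:=R) = (fun u : plane2 R => u.1 - u.2) @^-1` (~` [set 0]).
  apply/seteqP; split => u /= h k; apply: h.
    by apply/eqP; rewrite -subr_eq0 k.
  by rewrite k subrr.
apply: open_comp.
  by move=> u _; apply: cvgB; [exact: cvg_fst|exact: cvg_snd].
rewrite openC; apply/accessible_closed_set1/hausdorff_accessible.
exact: norm_hausdorff.
Qed.

Lemma graph_weight_gt0 (R : realType) (u : plane2 R) : R4circ u ->
  0 < norm2 (u.1 - u.2) * expR (- norm4 u).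
Proof.
case: u => [[x s] [y t]] /= u12; rewrite mulr_gt0 ?expR_gt0 // sqrtr_gt0.
rewrite lt_neqAle addr_ge0 ?sqr_ge0 // andbT eq_sym paddr_eq0 ?sqr_ge0 //.
rewrite !sqrf_eq0 /= !subr_eq0; apply/negP => /andP[/eqP xy /eqP st].
by apply: u12; rewrite xy st.
Qed.

(** Since [contract] is strictly increasing, bounds around [contract l] pull back to bounds around
    [l]. Conversely, on the eventually finite values it is the continuous map r / (1 + |r|). *)
Lemma cvg_contract (R : realType) (I : Type) (F : set_system I)
    (FF : Filter F) (f : I -> \bar R) (l : \bar R) : l \is a fin_num ->
  contract (f x) @[x --> F] --> contract l <-> f x @[x --> F] --> l.
Proof.
case: l => [r _|//|//]; split=> [fr|/fine_cvgP[ffin fr]].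
  apply: cvg_EFin_between => c.
    rewrite -lte_fin -lt_contract => /(cvgr_gt _ fr); apply: filterS => i.
    by rewrite lt_contract => /ltW.
  rewrite -lte_fin -lt_contract => /(cvgr_lt _ fr); apply: filterS => i.
  by rewrite lt_contract => /ltW.
have : (fine (f x) / (1 + `|fine (f x)|)) @[x --> F] --> r / (1 + `|r|).
  apply: cvgM => //; apply: cvgV.
    by rewrite gt_eqF // ltr_pwDl.
  by apply: cvgD; [exact: cvg_cst|exact: cvg_norm].
apply: cvg_trans; apply: near_eq_cvg; apply: filterS ffin => i.
by case: (f i).
Qed.

Lemma graph_cvg_near (R : realType) (d_ : nat -> plane2 R -> \bar R)
    (d : plane2 R -> \bar R) (e : R) :
  graph_cvg d_ d -> {in @R4circ R, continuous d} -> 0 < e ->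
  \forall n \near \oo, forall u, R4circ u ->
    exists v, [/\ R4circ v, ball u e v
      & `|norm2 (u.1 - u.2) * expR (- norm4 u) * contract (d_ n u) -
          norm2 (v.1 - v.2) * expR (- norm4 v) * contract (d v)| < e].
Proof.
move=> /fine_cvgP[hfin h0] dcont e0.
near=> n => u u12.
have : (hausdorff_dist (@dist5 R) (@graph_embedding R @` closed_graph (d_ n))
    (@graph_embedding R @` closed_graph d) < e%:E)%E.
  have hn : hausdorff_dist (@dist5 R) (@graph_embedding R @` closed_graph (d_ n))
    (@graph_embedding R @` closed_graph d) \is a fin_num by near: n.
  rewrite -(fineK hn) lte_fin; near: n; exact: cvgr_lt h0 _ e0.
(* The first supremum places every embedded point of the graph of [d_ n] within [e] of the embedded
   closed graph of [d], uniformly in [u]. *)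
rewrite /hausdorff_dist gt_max => /andP[+ _].
have du : closed_graph (d_ n) (u, d_ n u) by split=> //; apply: subset_closure.
move=> /(le_lt_trans (ereal_sup_ubound _)) => /(_ _).
move=> /(_ _ (ex_intro2 _ _ (graph_embedding (u, d_ n u)) _ erefl)).
move=> /(_ (ex_intro2 _ _ (u, d_ n u) du erefl)) /ereal_inf_lt.
move=> [_ [_ [[v a] dv <-] <-]].
rewrite lte_fin => /dist5_ball[uv].
case: (dv) => _ /= v12.
have /= -> := closed_graph_continuous dv (dcont _ (mem_set v12)).
by exists v.
Unshelve. all: by end_near. Qed.

(** Index and argument move together. Graph closeness compares the weighted value of [d_ n] at [u]
    with that of [d] at some nearby [v]; continuity of the weighted limit replaces [v] by [u0], and
    the weight, nonzero at [u0], is divided out. *)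
Lemma graph_cvg_continuous (R : realType) (d_ : nat -> plane2 R -> \bar R)
    (d : plane2 R -> \bar R) (u0 : plane2 R) :
  graph_cvg d_ d -> {within @R4circ R, continuous d} -> R4circ u0 ->
  d u0 \is a fin_num ->
  d_ p.1 p.2 @[p --> (\oo, nbhs u0)] --> d u0.
Proof.
move=> dd; rewrite continuous_open_subspace; last exact: open_R4circ.
move=> dcont u012 du0; apply/cvg_contract => //.
pose k (u : plane2 R) := norm2 (u.1 - u.2) * expR (- norm4 u).
have kcont : k u @[u --> u0] --> k u0 by exact: graph_weight_continuous.
have u0circ : \forall u \near u0, R4circ u.
  by apply: open_nbhs_nbhs; split => //; exact: open_R4circ.
have ku0 : k u0 != 0 by rewrite gt_eqF //; exact: graph_weight_gt0.
have k2 : k p.2 @[p --> (\oo, nbhs u0)] --> k u0.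
  by apply: cvg_comp kcont; exact: cvg_snd.
suff kd : (k p.2 * contract (d_ p.1 p.2)) @[p --> (\oo, nbhs u0)] -->
    k u0 * contract (d u0).
  have : ((k p.2)^-1 * (k p.2 * contract (d_ p.1 p.2))) @[p --> (\oo, nbhs u0)]
      --> (k u0)^-1 * (k u0 * contract (d u0)) by apply: cvgM; first exact: cvgV.
  rewrite mulKf //; apply: cvg_trans.
  apply: near_eq_cvg; near=> p; rewrite mulKf // gt_eqF //.
  by apply: graph_weight_gt0; near: p; exact: cvg_snd u0circ.
apply/cvgrPdist_lt => e e0.
have kdcont : (k u * contract (d u)) @[u --> u0] --> k u0 * contract (d u0).
  apply: cvgM => //; apply/cvg_contract => //; exact/dcont/mem_set.
have e2 : 0 < e / 2 by rewrite divr_gt0.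
have /nbhs_ballP[r /= r0 rP] : \forall u \near u0,
    `|k u0 * contract (d u0) - k u * contract (d u)| < e / 2.
  by move/cvgrPdist_lt : kdcont; apply.
(* The half [r / 2] keeps [v] within [r] of [u0], where [rP] applies; the half [e / 2] bounds the
   gap between the weighted values. *)
have r2 : 0 < Num.min (e / 2) (r / 2) by rewrite lt_min e2 divr_gt0.
near=> p.
have hp : forall u, R4circ u ->
    exists v, [/\ R4circ v, ball u (Num.min (e / 2) (r / 2)) v
      & `|k u * contract (d_ p.1 u) - k v * contract (d v)|
          < Num.min (e / 2) (r / 2)].
  by near: p; apply: cvg_fst (graph_cvg_near dd dcont r2).
have [|v [v12 pv]] := hp p.2.
  by near: p; exact: cvg_snd u0circ.
rewrite lt_min => /andP[pve _].
have u0p : ball u0 (r / 2) p.2.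
  by near: p; apply: cvg_snd (nbhsx_ballx _ _ _); rewrite divr_gt0.
have u0v : ball u0 r v.
  rewrite (splitr r); apply: ball_triangle u0p _; apply: le_ball pv.
  by rewrite ge_min lexx orbT.
rewrite (splitr e); apply: le_lt_trans (ltrD (rP _ u0v) pve).
by rewrite [X in _ <= _ + X]distrC ler_distD.
Unshelve. all: by end_near. Qed.

(** * Bounds on a single interface *)

(** The hypothesis, with the linear part moved to the left, says that [(y, w)] lies in the backward
    ball itself. *)
Lemma interface_ge (R : realType) (d : plane2 R -> \bar R) (a b x s y r w : R) :
  ((r - a * (x - y) - b * (s - w))%:E < d ((y, w), (x, s)))%E ->
  (w%:E <= interface (add_linear d a b) (x, s) r y)%E.
Proof.
move=> h; apply: ereal_sup_ubound; exists w => //; apply: subset_closure => /=.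
rewrite /backward_ball /add_linear /add_metric /additive_metric /linear_form /=.
by case: (d _) h => [f||] //=; rewrite -?EFinD ?lte_fin ?ltry //; lra.
Qed.

Lemma interface_le (R : realType) (d : plane2 R -> \bar R)
    (a b x s y r w c : R) :
  directed_metric d ->
  (forall x s t : R, s <= t -> (0 <= add_linear d a b ((x, s), (x, t)))%E) ->
  (\forall z \near y, (d ((z, w), (x, s)) <= c%:E)%E) ->
  c < r - a * (x - y) - b * (s - w) ->
  (interface (add_linear d a b) (x, s) r y <= w%:E)%E.
Proof.
move=> [dpoo _ dtri] dl0 dc cr; apply: ge_ereal_sup => _ [w' wcl <-].
rewrite lee_fin leNgt; apply/negP => ww'.
(* A point of the closure only provides ball points over nearby [z], so the strict inequality must
   persist around [y]. *)
have cr' : \forall z \near y, c < r - a * (x - z) - b * (s - w).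
  have : (r - a * (x - z) - b * (s - w)) @[z --> y] -->
      r - a * (x - y) - b * (s - w).
    apply: cvgB; last exact: cvg_cst.
    apply: cvgB; first exact: cvg_cst.
    by apply: cvgM; [exact: cvg_cst|apply: cvgB; [exact: cvg_cst|exact: cvg_id]].
  by move/cvgr_gt; apply.
have [|[z v] [/= zb [[/= dz rz] wv]]] :=
    wcl ([set z | (d ((z, w), (x, s)) <= c%:E)%E /\
                  c < r - a * (x - z) - b * (s - w)] `*` [set v | w < v]).
  exists ([set z | (d ((z, w), (x, s)) <= c%:E)%E /\
                  c < r - a * (x - z) - b * (s - w)], [set v | w < v]) => //=.
  by split; [apply: filterI|exact: lt_nbhsr].
(* Going from [(z, w)] up to the ball point [(z, v)] and then to [(x, s)] shows that [(z, w)] is in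
   the ball too, against the bound [c]. *)
have := dl0 z w v (ltW wv); have := dtri (z, w) (z, v) (x, s).
move: zb dz; rewrite /backward_ball /add_linear /add_metric.
rewrite /additive_metric /linear_form /=.
move: (dpoo ((z, w), (z, v))) (dpoo ((z, w), (x, s))) (dpoo ((z, v), (x, s))).
move: (d ((z, w), (z, v))) (d ((z, w), (x, s))) (d ((z, v), (x, s))).
move=> [e||] [f||] [g||] //= _ _ _; rewrite -?EFinD ?lee_fin ?lte_fin; lra.
Qed.

(** The shifted time is the [w] solving b w - b t - a (x - y) = c. At radius b (s - t) the threshold
    of [interface_ge] then equals [c]. *)
Lemma rescaled_interface_ge (R : realType) (d : plane2 R -> \bar R)
    (a b x s y t c : R) : 0 < b ->
  (c%:E < d ((y, (t + (c / b + a / b * (x - y)))%R), (x, s)))%E ->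
  (c%:E <= rescaled_interface a b (add_linear d a b) ((y, t), (x, s)))%E.
Proof.
move=> b0 dc; rewrite /rescaled_interface leeBrDr // leeBrDr // -!EFinD.
have -> : c + a * (x - y) + b * t = b * (t + (c / b + a / b * (x - y))).
  by field; rewrite gt_eqF.
rewrite EFinM lee_pmul2l // ?lte_fin //; apply: interface_ge.
by rewrite [X in X%:E](_ : _ = c) //; field; rewrite gt_eqF.
Qed.

Lemma rescaled_interface_le (R : realType) (d : plane2 R -> \bar R)
    (a b x s y t c c' : R) : directed_metric d -> 0 < b ->
  (forall x s t : R, s <= t -> (0 <= add_linear d a b ((x, s), (x, t)))%E) ->
  c' < c ->
  (\forall z \near y,
    (d ((z, (t + (c / b + a / b * (x - y)))%R), (x, s)) <= c'%:E)%E) ->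
  (rescaled_interface a b (add_linear d a b) ((y, t), (x, s)) <= c%:E)%E.
Proof.
move=> dm b0 dl0 cc' dc; rewrite /rescaled_interface leeBlDr // leeBlDr // -!EFinD.
have -> : c + a * (x - y) + b * t = b * (t + (c / b + a / b * (x - y))).
  by field; rewrite gt_eqF.
rewrite EFinM lee_pmul2l // ?lte_fin //; apply: interface_le dc _ => //.
by rewrite [ltRHS](_ : _ = c) //; field; rewrite gt_eqF.
Qed.

(** * From joint convergence to uniform convergence on compact sets *)

(** Continuity of [g] makes the error tend to 0 jointly in index and point near each [u]; the
    near-covering form of compactness then yields one threshold for all of [K]. *)
Lemma cvg_unif_on_compacts_near (R : realType) (T : topologicalType) (D : set T)
    (f_ : nat -> T -> \bar R) (g : T -> \bar R) :
  (forall u, D u -> g u \is a fin_num) ->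
  (forall u, D u -> {for u, continuous g}) ->
  (forall u, D u -> f_ p.1 p.2 @[p --> (\oo, nbhs u)] --> g u) ->
  cvg_unif_on_compacts D f_ g.
Proof.
move=> gfin gcont fg K /compact_near_coveringP Kcov KD e e0.
apply: Kcov => u /KD Du.
have : (`|f_ p.1 p.2 - g p.2|)%E @[p --> (\oo, nbhs u)] --> 0%E.
  rewrite -[0%E]abse0 -(subee (gfin u Du)); apply: cvg_abse; apply: cvgeB.
  - by rewrite fin_num_adde_defl // fin_numN gfin.
  - exact: fg.
  - have gu : g v @[v --> u] --> g u by exact: gcont.
    by apply: cvg_comp gu; exact: cvg_snd.
move=> /fine_cvgP[fin /cvgr_lt /(_ _ e0) lte].
have [[A B] [/= nA uB] AB] := filterI fin lte.
exists (B, A) => // -[v n] [/= Bv An]; have [/= fnv] := AB (n, v) (conj An Bv).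
by rewrite -lte_fin fineK.
Qed.

Lemma cvg_coords (R : realType) (I : Type) (F : set_system I)
    (FF : Filter F) (v : I -> plane2 R) (u : plane2 R) :
  v i @[i --> F] --> u ->
  [/\ (v i).1.1 @[i --> F] --> u.1.1, (v i).1.2 @[i --> F] --> u.1.2,
      (v i).2.1 @[i --> F] --> u.2.1 & (v i).2.2 @[i --> F] --> u.2.2].
Proof.
move=> vu.
have v1 : (v i).1 @[i --> F] --> u.1 by apply: cvg_comp vu _; exact: cvg_fst.
have v2 : (v i).2 @[i --> F] --> u.2 by apply: cvg_comp vu _; exact: cvg_snd.
by split; [apply: cvg_comp v1 _; exact: cvg_fst
          |apply: cvg_comp v1 _; exact: cvg_snd
          |apply: cvg_comp v2 _; exact: cvg_fst
          |apply: cvg_comp v2 _; exact: cvg_snd].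
Qed.

Lemma cvg_quadruple (R : realType) (I : Type) (F : set_system I)
    (FF : Filter F) (f g h k : I -> R) (y t x s : R) :
  f i @[i --> F] --> y -> g i @[i --> F] --> t ->
  h i @[i --> F] --> x -> k i @[i --> F] --> s ->
  ((f i, g i), (h i, k i)) @[i --> F] --> ((y, t), (x, s)).
Proof. by move=> fy gt hx ks; exact: cvg_pair (cvg_pair fy gt) (cvg_pair hx ks). Qed.

(** Serves both the time shift c / b + (a / b) (x - y) of the interface and the starting time (g - a
    x) / b of the height. *)
Lemma cvg_drift (R : realType) (I : Type) (F : set_system I) (FF : Filter F)
    (a b : nat -> R) (m : I -> nat) (f h : I -> R) (c k : R) :
  (forall n, 0 < b n) ->
  b n @[n --> \oo] --> +oo -> a n / b n @[n --> \oo] --> (0 : R) ->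
  m i @[i --> F] --> \oo -> f i @[i --> F] --> c -> h i @[i --> F] --> k ->
  (f i / b (m i) + a (m i) / b (m i) * h i) @[i --> F] --> (0 : R).
Proof.
move=> b0 boo ab moo fc hk.
have bV : (b (m i))^-1 @[i --> F] --> (0 : R).
  apply: (@cvg_comp _ _ _ m (fun n => (b n)^-1)); first exact: moo.
  by apply/gtr0_cvgV0 => //; exact: nearW.
have abm : a (m i) / b (m i) @[i --> F] --> (0 : R).
  by apply: (@cvg_comp _ _ _ m (fun n => a n / b n)) ab; exact: moo.
rewrite (_ : 0 = c * 0 + 0 * k); first by apply: cvgD; exact: cvgM.
by rewrite mulr0 mul0r addr0.
Qed.

(** * Limits of the rescaled interfaces and heights *)

Lemma rescaled_interface_cvg (R : realType) (d_ : nat -> plane2 R -> \bar R)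
    (d : plane2 R -> \bar R) (a b : nat -> R) (u : plane2 R) :
  (forall n, directed_metric (d_ n)) -> (forall n, 0 < b n) ->
  b n @[n --> \oo] --> +oo -> a n / b n @[n --> \oo] --> (0 : R) ->
  (forall n (x s t : R), s <= t ->
     (0 <= add_linear (d_ n) (a n) (b n) ((x, s), (x, t)))%E) ->
  d u \is a fin_num -> d_ p.1 p.2 @[p --> (\oo, nbhs u)] --> d u ->
  rescaled_interface (a p.1) (b p.1) (add_linear (d_ p.1) (a p.1) (b p.1)) p.2
    @[p --> (\oo, nbhs u)] --> d u.
Proof.
move=> dm b0 boo ab dl0 du dcvg.
(* The point at which [d_ n] is compared with the level [c]: the first time coordinate carries a
   shift that vanishes in the limit. *)
pose theta (c : R) (p : nat * plane2 R) : plane2 R :=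
  ((p.2.1.1, p.2.1.2 + (c / b p.1 + a p.1 / b p.1 * (p.2.2.1 - p.2.1.1))),
   (p.2.2.1, p.2.2.2)).
have theta_cvg c : theta c p @[p --> (\oo, nbhs u)] --> u.
  have u2 : p.2 @[p --> (\oo, nbhs u)] --> u by exact: cvg_snd.
  have [u11 u12 u21 u22] := cvg_coords _ u2.
  have u12' : (p.2.1.2 + (c / b p.1 + a p.1 / b p.1 * (p.2.2.1 - p.2.1.1)))
      @[p --> (\oo, nbhs u)] --> u.1.2.
    rewrite -[u.1.2]addr0; apply: cvgD => //.
    apply: cvg_drift => //; [exact: cvg_fst|exact: cvg_cst|exact: cvgB u21 u11].
  have -> : nbhs u = nbhs ((u.1.1, u.1.2), (u.2.1, u.2.2)).
    by case: (u) => [[? ?] [? ?]].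
  exact: cvg_quadruple.
have [l dul] : exists l, d u = l%:E by exists (fine (d u)); rewrite fineK.
have theta2_cvg c : (p.1, theta c p) @[p --> (\oo, nbhs u)] --> (\oo, nbhs u).
  by apply: cvg_pair => //; exact: cvg_fst.
rewrite dul in dcvg *; apply: cvg_EFin_between => c lc.
  have cd : \forall p \near (\oo, nbhs u), (c%:E < d_ p.1 p.2)%E.
    apply: (dcvg [set z | (c%:E < z)%E]); apply: open_nbhs_nbhs.
    by split; [exact: open_ereal_gt_ereal|rewrite /= lte_fin].
  have {cd} : \forall p \near (\oo, nbhs u), (c%:E < d_ p.1 (theta c p))%E.
    exact: (theta2_cvg c _ cd).
  apply: filterS => -[n [[y t] [x s]]] /=; exact: rescaled_interface_ge.
(* The midpoint is the lower level [c'] demanded by [rescaled_interface_le]. *)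
have lm : l < (l + c) / 2 by lra.
have mc : (l + c) / 2 < c by lra.
have [[A B] [/= nA uB] AB] : \forall p \near (\oo, nbhs u),
    (d_ p.1 p.2 < ((l + c) / 2)%:E)%E.
  apply: (dcvg [set z | (z < ((l + c) / 2)%:E)%E]); apply: open_nbhs_nbhs.
  by split; [exact: open_ereal_lt_ereal|rewrite /= lte_fin].
(* The interior is taken so that the bound at [theta c p] extends to all [z] near [y] with the same
   [n]. *)
have AB0 : \forall p \near (\oo, nbhs u), (A `*` B°) p.
  by exists (A, B°) => //; split => //; exact: nbhs_interior.
have {AB0} : \forall p \near (\oo, nbhs u), A p.1 /\ B° (theta c p).
  exact: (theta2_cvg c _ AB0).
apply: filterS => -[n [[y t] [x s]]] [/= nAn thB].
apply: (rescaled_interface_le (dm n) (b0 n) (dl0 n) mc).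
rewrite /theta /= in thB; set w := t + _ in thB *.
have zyw : ((z, w), (x, s)) @[z --> y] --> ((y, w), (x, s)).
  by apply: cvg_quadruple; [exact: cvg_id|exact: cvg_cst..].
have {thB} : \forall z \near y, B ((z, w), (x, s)) by exact: (zyw _ thB).
apply: filterS => z zB; apply/ltW; exact: (AB (n, _)).
Qed.

(** With s = (g - a x) / b, the time s - t gives radius b t, and -b s = a x - g cancels -a x,
    leaving -g to be compensated. *)
Lemma rescaled_height_interface (R : realType) (a b : R) (m : plane2 R -> \bar R)
    (y t x g : R) : b != 0 ->
  rescaled_height a b m ((y, t), (x, g)) =
  (rescaled_interface a b m
     ((y, ((g - a * x) / b - t)%R), (x, ((g - a * x) / b)%R)) + g%:E)%E.
Proof.
move=> b0; rewrite /rescaled_height /rescaled_interface subKr.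
rewrite -!addeA -!EFinN -!EFinD; congr (_ + _%:E)%E; field.
exact: b0.
Qed.

Theorem theorem15p2 (R : realType)
  (d_ : nat -> plane2 R -> \bar R) (d : plane2 R -> \bar R)
  (a b : nat -> R)
  (d_metric : forall n, directed_metric (d_ n))
  (d_Ny : forall n (x s y t : R), t < s -> d_ n ((x, s), (y, t)) = -oo%E)
  (dmetric : directed_metric d)
  (dcont : {within @R4circ R, continuous d})
  (dfin : forall u, R4up u -> d u \is a fin_num)
  (d_cvg : graph_cvg d_ d)
  (b_gt0 : forall n, 0 < b n)
  (b_cvg : b n @[n --> \oo] --> +oo)
  (ab_cvg : a n / b n @[n --> \oo] --> (0 : R))
  (dl_ge0 : forall n (x s t : R), s <= t ->
     (0 <= add_linear (d_ n) (a n) (b n) ((x, s), (x, t)))%E) :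
  cvg_unif_on_compacts (@R4up R)
    (fun n =>
       rescaled_interface (a n) (b n) (add_linear (d_ n) (a n) (b n))) d /\
  cvg_unif_on_compacts [set u : plane2 R | 0 < u.1.2]
    (fun n => rescaled_height (a n) (b n) (add_linear (d_ n) (a n) (b n))) (height_limit d).
Proof.
have dcont' : {in @R4circ R, continuous d}.
  by rewrite -continuous_open_subspace //; exact: open_R4circ.
have up_circ (u : plane2 R) : R4up u -> R4circ u.
  by rewrite /R4up /R4circ /= => lt12 eq12; rewrite eq12 ltxx in lt12.
have icvg u : R4up u ->
    rescaled_interface (a p.1) (b p.1) (add_linear (d_ p.1) (a p.1) (b p.1)) p.2
      @[p --> (\oo, nbhs u)] --> d u.
  move=> uup; apply: rescaled_interface_cvg => //; first exact: dfin.
  by apply: graph_cvg_continuous => //; [exact: up_circ|exact: dfin].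
have dfor u : R4up u -> d v @[v --> u] --> d u.
  by move=> uup; apply: dcont'; apply/mem_set/up_circ.
(* With r = (g - a x) / b this is the argument of the interface behind the height; with r = 0 it is
   the argument of [d] in the limit. *)
pose chi (r : R) (u : plane2 R) : plane2 R := ((u.1.1, r - u.1.2), (u.2.1, r)).
have limE u : height_limit d u = (d (chi 0%R u) + (u.2.2)%:E)%E.
  by case: u => [[y t] [x g]]; rewrite /chi /= sub0r.
have heightE n u :
    rescaled_height (a n) (b n) (add_linear (d_ n) (a n) (b n)) u =
    (rescaled_interface (a n) (b n) (add_linear (d_ n) (a n) (b n))
       (chi ((u.2.2 - a n * u.2.1) / b n)%R u) + (u.2.2)%:E)%E.
  by case: u => [[y t] [x g]]; rewrite rescaled_height_interface // gt_eqF.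
have chi_up (u : plane2 R) : 0 < u.1.2 -> R4up (chi 0 u).
  by move=> t0; rewrite /R4up /= sub0r oppr_lt0.
have chi_cvg I (F : set_system I) (FF : Filter F) (f : I -> R)
    (v : I -> plane2 R) (u : plane2 R) :
    f i @[i --> F] --> 0 -> v i @[i --> F] --> u ->
    chi (f i) (v i) @[i --> F] --> chi 0 u.
  move=> f0 vu; have [u11 u12 u21 _] := cvg_coords _ vu.
  by apply: cvg_quadruple => //; exact: cvgB.
have g_cvg I (F : set_system I) (FF : Filter F) (v : I -> plane2 R)
    (u : plane2 R) :
    v i @[i --> F] --> u -> ((v i).2.2)%:E @[i --> F] --> (u.2.2)%:E.
  move=> vu; have [_ _ _ u22] := cvg_coords _ vu.
  by apply/fine_cvgP; split => //; exact: nearW.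
split; apply: cvg_unif_on_compacts_near => //.
- by move=> [[y t] [x g]] /= t0; rewrite fin_numD dfin //= /R4up /= oppr_lt0.
- move=> u t0; suff : height_limit d v @[v --> u] --> height_limit d u by [].
  rewrite limE (eq_cvg _ _ limE).
  apply: cvgeD; last exact: g_cvg cvg_id.
    by rewrite fin_num_adde_defl.
  by apply: cvg_comp (dfor _ (chi_up _ t0)); apply: chi_cvg (cvg_cst _) cvg_id.
- move=> u t0; rewrite limE (eq_cvg _ _ (fun p => heightE p.1 p.2)).
  apply: cvgeD; last by apply: g_cvg; exact: cvg_snd.
    by rewrite fin_num_adde_defl.
  (* The interface is evaluated at a point that itself depends on [n], so its joint convergence at
     [chi 0 u] is what gets composed. *)
  have hcvg : (p.1, chi ((p.2.2.2 - a p.1 * p.2.2.1) / b p.1) p.2)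
      @[p --> (\oo, nbhs u)] --> (\oo, nbhs (chi 0 u)).
    apply: cvg_pair; first exact: cvg_fst.
    apply: chi_cvg; last exact: cvg_snd.
    have [_ _ u21 u22] := cvg_coords _ (@cvg_snd _ _ \oo (nbhs u) _).
    (* Rewrites (g - a x) / b as g / b + (a / b) (-x), the shape of [cvg_drift]. *)
    under eq_cvg do rewrite mulrBl mulrAC -mulrN.
    apply: cvg_drift => //; [exact: cvg_fst|exact: u22|exact: cvgN u21].
  exact: (cvg_comp _ _ hcvg (icvg _ (chi_up _ t0))).
Qed.
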